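(* Let $L:\mathbb{R}^n\times\mathbb{R}^m\to\mathbb{R}$ be three times differentiable and let $F(z)=[\nabla_xL(x,w),-\nabla_wL(x,w)]$ for $z=(x,w)\in\mathbb{R}^{n+m}$. Suppose there is $z^*\in\mathbb{R}^{n+m}$ such that: (i) $F(z^* )=0$ and $\nabla F(z^* )$ is invertible, with $\gamma=\|\nabla F(z^* )^{-1}\|$; (ii) there are $\epsilon>0$ and $\Lambda>0$ such that $\|\nabla F(z)-\nabla F(z^* )\|\le\Lambda\|z-z^*\|$ for all $z$ with $\|z-z^*\|<\epsilon$. Then for any given $0<r<1$ there exist positive constants $\bar\epsilon$ and $\delta$ such that for any $z_0$ with $\|z_0-z^*\|<\bar\epsilon$ and any $J$-symmetric $B_0$ with $\|B_0-\nabla F(z^* )\|_F<\delta$, the following hold for the unit-step $J$-symmetric quasi-Newton algorithm (described in the context) started from $z_0$ and $B_0$: (a) The sequence $\{z_k\}$ generated by the algorithm is well defined and converges to $z^*$, and $\{\|B_k\|\}$ and $\{\|B_k^{-1}\|\}$ are uniformly bounded over $k\ge0$. Additionally, $\|z_{k+1}-z^*\|\le r\|z_k-z^*\|$ for all $k\ge 0$. (b) The iterates $\{z_k\}$ converge Q-superlinearly to $z^*$.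
   Context: Norms: $\|\cdot\|$ is the Euclidean norm for vectors and the induced operator norm for matrices; $\|\cdot\|_F$ is the Frobenius norm. $\nabla F(z)$ is the Jacobian of $F$ at $z$. $J=\begin{bmatrix} I_{n\times n}&0\\0&-I_{m\times m}\end{bmatrix}$; a matrix $M\in\mathbb{R}^{(n+m)\times(n+m)}$ is $J$-symmetric if $M=JM^TJ$ (the Jacobian $\nabla F(z)$ is $J$-symmetric). Unit-step $J$-symmetric quasi-Newton algorithm: given $z_0$ and an initial Jacobian estimate $B_0$ (with inverse $H_0=B_0^{-1}$), for $k=0,1,2,\ldots$ set $$s_k=-B_k^{-1}F(z_k),\qquad z_{k+1}=z_k+s_k,\qquad y_k=F(z_{k+1})-F(z_k),$$ $$B_{k+1}=B_k+\frac{Js_k(y_k-B_ks_k)^TJ}{s_k^Ts_k}+\frac{(y_k-B_ks_k)s_k^T}{s_k^Ts_k}-\frac{(Js_k)^T(y_k-B_ks_k)\,Js_ks_k^T}{(s_k^Ts_k)^2}.$$ (The algorithm maintains the inverse $H_k=B_k^{-1}$.) If $F(z_k)=0$ for some $k$, then $s_k=0$ and the algorithm stops; the sequence is understood as constant from then on, $z_j=z_k$ and $B_j=B_k$ for $j\ge k$. Q-superlinear convergence of $\{z_k\}$ to $z^*$ means that there is a sequence $q_k\to0$ with $\|z_{k+1}-z^*\|\le q_k\|z_k-z^*\|$ for all $k$. *)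

(* Defs.v *)
From HB Require Import structures.
From mathcomp Require Import all_boot all_order all_algebra.
From mathcomp Require Import all_classical all_reals all_analysis.
Set Implicit Arguments.
Unset Strict Implicit.
Unset Printing Implicit Defensive.
Import Order.TTheory GRing.Theory Num.Theory.
Import numFieldNormedType.Exports.
Local Open Scope classical_set_scope.
Local Open Scope ring_scope.

(* Vectors are columns.  The canonical norm of 'cV[R]_d in the library is the
   sup norm, so the Euclidean, operator and Frobenius norms are introduced
   here; the topology of 'cV[R]_d is the usual one for either norm. *)

Definition dotv (R : realType) (d : nat) (u v : 'cV[R]_d) : R :=
  (u^T *m v) 0 0.

Definition enorm (R : realType) (d : nat) (v : 'cV[R]_d) : R :=
  Num.sqrt (\sum_i v i 0 ^+ 2).

(* The set below is nonempty (v = 0) and bounded, so this is a true supremum. *)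
Definition opnorm (R : realType) (d : nat) (A : 'M[R]_d) : R :=
  sup [set enorm (A *m v) | v in [set v : 'cV[R]_d | enorm v <= 1]].

Definition fnorm (R : realType) (d : nat) (A : 'M[R]_d) : R :=
  Num.sqrt (\sum_i \sum_j A i j ^+ 2).

Definition partial (R : realType) (d : nat) (j : 'I_d)
    (f : 'cV[R]_d -> R) (z : 'cV[R]_d) : R :=
  'D_(delta_mx j 0) f z.

Definition grad (R : realType) (d : nat) (f : 'cV[R]_d -> R)
    (z : 'cV[R]_d) : 'cV[R]_d :=
  \col_i partial i f z.

(* Column convention: 'd G z v = jac G z *m v.  The library's [jacobian] is for
   row vectors and is the transpose of this matrix. *)
Definition jac (R : realType) (d : nat) (G : 'cV[R]_d -> 'cV[R]_d)
    (z : 'cV[R]_d) : 'M[R]_d :=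
  \matrix_(i, j) partial j (fun x => G x i 0) z.

(* [differentiable] is Fréchet differentiability; the first and second
   derivatives of f are represented by its gradient and its Hessian. *)
Definition thrice_differentiable (R : realType) (d : nat)
    (f : 'cV[R]_d -> R) : Prop :=
  forall z, [/\ differentiable f z, differentiable (grad f) z
              & differentiable (jac (grad f)) z].

Definition saddle_fun (R : realType) (n m : nat)
    (L : 'cV[R]_n -> 'cV[R]_m -> R) (z : 'cV[R]_(n + m)) : R :=
  L (usubmx z) (dsubmx z).

Definition saddle_field (R : realType) (n m : nat)
    (L : 'cV[R]_n -> 'cV[R]_m -> R) (z : 'cV[R]_(n + m)) : 'cV[R]_(n + m) :=
  col_mx (grad (fun x => L x (dsubmx z)) (usubmx z))
         (- grad (fun w => L (usubmx z) w) (dsubmx z)).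

Definition Jmx (R : realType) (n m : nat) : 'M[R]_(n + m) :=
  block_mx 1%:M 0 0 (- 1%:M).

Definition J_symmetric (R : realType) (n m : nat) (M : 'M[R]_(n + m)) : Prop :=
  M = Jmx R n m *m M^T *m Jmx R n m.

Definition jsym_update (R : realType) (n m : nat) (B : 'M[R]_(n + m))
    (s y : 'cV[R]_(n + m)) : 'M[R]_(n + m) :=
  let J := Jmx R n m in
  let e := y - B *m s in
  B + (dotv s s)^-1 *: (J *m s *m e^T *m J)
    + (dotv s s)^-1 *: (e *m s^T)
    - (dotv (J *m s) e / dotv s s ^+ 2) *: (J *m s *m s^T).

Definition qn_dir (R : realType) (d : nat) (F : 'cV[R]_d -> 'cV[R]_d)
    (z : 'cV[R]_d) (B : 'M[R]_d) : 'cV[R]_d :=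
  - (invmx B *m F z).

Definition jsym_step (R : realType) (n m : nat)
    (F : 'cV[R]_(n + m) -> 'cV[R]_(n + m))
    (zB : 'cV[R]_(n + m) * 'M[R]_(n + m)) : 'cV[R]_(n + m) * 'M[R]_(n + m) :=
  let: (z, B) := zB in
  if F z == 0 then (z, B)
  else let s := qn_dir F z B in
       (z + s, jsym_update B s (F (z + s) - F z)).

Definition qn_z (R : realType) (n m : nat)
    (F : 'cV[R]_(n + m) -> 'cV[R]_(n + m)) (z0 : 'cV[R]_(n + m))
    (B0 : 'M[R]_(n + m)) (k : nat) : 'cV[R]_(n + m) :=
  (iter k (jsym_step F) (z0, B0)).1.

Definition qn_B (R : realType) (n m : nat)
    (F : 'cV[R]_(n + m) -> 'cV[R]_(n + m)) (z0 : 'cV[R]_(n + m))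
    (B0 : 'M[R]_(n + m)) (k : nat) : 'M[R]_(n + m) :=
  (iter k (jsym_step F) (z0, B0)).2.

(* [invmx] and division are total functions, so that the algorithm never
   breaks down has to be stated: every B_k is invertible, and s_k^T s_k is
   nonzero whenever the update is performed. *)
Definition qn_well_defined (R : realType) (n m : nat)
    (F : 'cV[R]_(n + m) -> 'cV[R]_(n + m)) (z0 : 'cV[R]_(n + m))
    (B0 : 'M[R]_(n + m)) : Prop :=
  forall k, let z := qn_z F z0 B0 k in let B := qn_B F z0 B0 k in
    B \in unitmx /\
    (F z <> 0 -> dotv (qn_dir F z B) (qn_dir F z B) <> 0).

Definition Q_superlinear (R : realType) (d : nat)
    (z : nat -> 'cV[R]_d) (zs : 'cV[R]_d) : Prop :=
  exists q : nat -> R, q @ \oo --> (0 : R) /\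
    forall k, enorm (z k.+1 - zs) <= q k * enorm (z k - zs).

(* Main.v *)
Require Import Defs.
From HB Require Import structures.
From mathcomp Require Import all_boot all_order all_algebra.
From mathcomp Require Import all_classical all_reals all_analysis.
From mathcomp Require Import ring lra.
Import Order.TTheory GRing.Theory Num.Theory.
Import numFieldNormedType.Exports.
Local Open Scope classical_set_scope.
Local Open Scope ring_scope.

Set Implicit Arguments.
Unset Strict Implicit.
Unset Printing Implicit Defensive.

(** Write A for the Jacobian of F at the solution z*, E_k = B_k - A for the
    error of the Jacobian estimate and e_k for the distance from z_k to z*.

    Since F = J grad L, the matrix J A is a Hessian; as L is smooth enough the
    Hessian is symmetric ([jac_grad_sym]), so A is J-symmetric.  Multiplied on
    the left by the orthogonal matrix J, the update becomes Powell's symmetric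
    rank-two update of the symmetric matrix J B_k.  In terms of M = J E_k the
    new error is P M P, with P the orthogonal projection along the step s, plus
    two rank-one matrices of size at most |y - A s| / |s|
    ([jsym_update_error]).  Passing from M to P M P removes at least
    (|M s| / |s|)^2 from the squared Frobenius norm.  Hence, with
    theta_k = |E_k s_k| / |s_k| and a bound D on |E_k|,
<<
      |E_(k+1)| <= |E_k| + O(e_k) - theta_k^2 / (2 D)
>>
    ([jsym_update_deterioration]); the O(e_k) comes from the mean value theorem
    applied to F, whose Jacobian is Lipschitz at z* ([jac_linearized_near]).

    While E_k and e_k are small, B_k is bounded below like A, and
<<
      B_k (z_(k+1) - z* ) = E_k (z_k - z* ) - (F z_k - F z* - A (z_k - z* ))
>>
    gives e_(k+1) <= r e_k.  The errors e_k are then dominated by a geometric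
    sequence, so the increments O(e_k) have a small total and E_k remains
    small.  Adding to |E_k| the geometric tail of these increments gives a
    nonincreasing nonnegative potential, which drops by at least
    theta_k^2 / (2 D) at each step; therefore theta_k tends to 0.  Finally
    F z_(k+1) = (y_k - A s_k) - E_k s_k, so that e_(k+1) is at most a multiple
    of (e_k + theta_k) e_k, which is Q-superlinear convergence.

    The Frobenius norm [hsnorm] of rectangular matrices serves throughout as
    the only norm: it specializes to the Euclidean norm of columns and it is
    submultiplicative, which covers both the size of a matrix-vector product
    and that of a rank-one matrix. *)

(** * The Frobenius norm, with its Euclidean and operator counterparts *)

(** Obtained by expanding the nonnegative sum of the squares of
    (sum b^2) a_i - (sum a b) b_i. *)
Lemma sum_CauchySchwarz (R : realFieldType) (I : finType) (a b : I -> R) :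
  (\sum_i a i * b i) ^+ 2 <= (\sum_i a i ^+ 2) * (\sum_i b i ^+ 2).
Proof.
set S := \sum_i a i * b i; set A := \sum_i a i ^+ 2; set B := \sum_i b i ^+ 2.
have B_ge0 : 0 <= B by apply: sumr_ge0 => i _; exact: sqr_ge0.
have [B0|B_neq0] := eqVneq B 0.
  have b0 i : b i = 0.
    have /psumr_eq0P : B = 0 by [].
    move=> /(_ (fun i _ => sqr_ge0 (b i)) i isT) /eqP.
    by rewrite sqrf_eq0 => /eqP.
  by rewrite /S B0 mulr0 big1 ?expr0n// => i _; rewrite b0 mulr0.
have B_gt0 : 0 < B by rewrite lt_def B_neq0.
have : 0 <= \sum_i (B * a i - S * b i) ^+ 2.
  by apply: sumr_ge0 => i _; exact: sqr_ge0.
have -> : \sum_i (B * a i - S * b i) ^+ 2 = B * (A * B - S ^+ 2).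
  have -> : B * (A * B - S ^+ 2) = B ^+ 2 * A - (B * S) * S *+ 2 + S ^+ 2 * B.
    by ring.
  rewrite [X in X - _ + _]mulr_sumr [X in _ - X *+ 2 + _]mulr_sumr.
  rewrite [X in _ + X]mulr_sumr -sumrMnl -sumrB -big_split/=.
  by apply: eq_bigr => i _; ring.
by rewrite pmulr_rge0// subr_ge0.
Qed.

(** The Hilbert-Schmidt (Frobenius) norm, on rectangular matrices so that it
    applies to columns, rows and square matrices alike. *)
Definition hsnorm (R : realType) (p q : nat) (A : 'M[R]_(p, q)) : R :=
  Num.sqrt (\sum_i \sum_j A i j ^+ 2).

Lemma hsnorm_ge0 (R : realType) (p q : nat) (A : 'M[R]_(p, q)) :
  0 <= hsnorm A.
Proof. exact: sqrtr_ge0. Qed.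

Lemma sqr_hsnorm (R : realType) (p q : nat) (A : 'M[R]_(p, q)) :
  hsnorm A ^+ 2 = \sum_i \sum_j A i j ^+ 2.
Proof.
by rewrite sqr_sqrtr// sumr_ge0// => i _; rewrite sumr_ge0// => j _; exact: sqr_ge0.
Qed.

Lemma sqr_hsnorm_tr (R : realType) (p q : nat) (A : 'M[R]_(p, q)) :
  hsnorm A ^+ 2 = \tr (A^T *m A).
Proof.
rewrite sqr_hsnorm exchange_big; apply: eq_bigr => j _.
by rewrite mxE; apply: eq_bigr => i _; rewrite mxE expr2.
Qed.

Lemma enormE (R : realType) (d : nat) (v : 'cV[R]_d) : enorm v = hsnorm v.
Proof. by congr Num.sqrt; apply: eq_bigr => i _; rewrite big_ord1. Qed.

Lemma hsnorm_trmx (R : realType) (p q : nat) (A : 'M[R]_(p, q)) :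
  hsnorm A^T = hsnorm A.
Proof.
rewrite /hsnorm exchange_big; congr Num.sqrt.
by apply: eq_bigr => i _; apply: eq_bigr => j _; rewrite mxE.
Qed.

Lemma hsnorm_entry (R : realType) (p q : nat) (A : 'M[R]_(p, q)) i j :
  `|A i j| <= hsnorm A.
Proof.
rewrite -(@ler_pXn2r _ 2)// ?nnegrE ?hsnorm_ge0// real_normK ?num_real//.
rewrite sqr_hsnorm (bigD1 i)//= (bigD1 j)//= -addrA lerDl addr_ge0//.
  by apply: sumr_ge0 => k _; exact: sqr_ge0.
by apply: sumr_ge0 => k _; apply: sumr_ge0 => l _; exact: sqr_ge0.
Qed.

Lemma hsnorm0 (R : realType) (p q : nat) : hsnorm (0 : 'M[R]_(p, q)) = 0.
Proof.
by rewrite /hsnorm big1 ?sqrtr0// => i _; rewrite big1// => j _; rewrite mxE expr0n.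
Qed.

Lemma hsnorm_eq0 (R : realType) (p q : nat) (A : 'M[R]_(p, q)) :
  hsnorm A = 0 -> A = 0.
Proof.
move=> A0; apply/matrixP => i j; rewrite mxE; apply/eqP.
by rewrite -normr_le0 -A0 hsnorm_entry.
Qed.

Lemma hsnormZ (R : realType) (p q : nat) (c : R) (A : 'M[R]_(p, q)) :
  hsnorm (c *: A) = `|c| * hsnorm A.
Proof.
rewrite /hsnorm -sqrtr_sqr -sqrtrM ?sqr_ge0// mulr_sumr; congr Num.sqrt.
by apply: eq_bigr => i _; rewrite mulr_sumr; apply: eq_bigr => j _; rewrite mxE exprMn.
Qed.

Lemma hsnormN (R : realType) (p q : nat) (A : 'M[R]_(p, q)) :
  hsnorm (- A) = hsnorm A.
Proof. by rewrite -scaleN1r hsnormZ normrN1 mul1r. Qed.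

Lemma hsnormD (R : realType) (p q : nat) (A B : 'M[R]_(p, q)) :
  hsnorm (A + B) <= hsnorm A + hsnorm B.
Proof.
rewrite -(@ler_pXn2r _ 2)// ?nnegrE ?addr_ge0 ?hsnorm_ge0// sqrrD.
rewrite !sqr_hsnorm !pair_bigA/=.
set a := \sum_i A _ _ ^+ 2; set b := \sum_i B _ _ ^+ 2.
have -> : \sum_ij (A + B) ij.1 ij.2 ^+ 2 =
    a + (\sum_ij A ij.1 ij.2 * B ij.1 ij.2) *+ 2 + b.
  rewrite /a /b -sumrMnl -!big_split/=; apply: eq_bigr => ij _.
  by rewrite mxE sqrrD.
rewrite lerD2r lerD2l lerMn2r/=.
have ab0 : 0 <= hsnorm A * hsnorm B by rewrite mulr_ge0 ?hsnorm_ge0.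
apply: (le_trans (ler_norm _)).
rewrite -(@ler_pXn2r _ 2)// ?nnegrE// real_normK ?num_real// exprMn.
by rewrite !sqr_hsnorm !pair_bigA; exact: sum_CauchySchwarz.
Qed.

Lemma hsnormB (R : realType) (p q : nat) (A B : 'M[R]_(p, q)) :
  hsnorm (A - B) <= hsnorm A + hsnorm B.
Proof. by rewrite -(hsnormN B) hsnormD. Qed.

Lemma hsnormM (R : realType) (p q l : nat) (A : 'M[R]_(p, q))
    (B : 'M[R]_(q, l)) :
  hsnorm (A *m B) <= hsnorm A * hsnorm B.
Proof.
rewrite -(@ler_pXn2r _ 2)// ?nnegrE ?mulr_ge0 ?hsnorm_ge0// exprMn.
rewrite !sqr_hsnorm mulr_suml; apply: ler_sum => i _.
rewrite [X in _ * X]exchange_big/= mulr_sumr; apply: ler_sum => j _.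
by rewrite mxE; exact: sum_CauchySchwarz.
Qed.

Lemma hsnorm_isom (R : realType) (p q : nat) (Q : 'M[R]_p)
    (A : 'M[R]_(p, q)) :
  Q^T *m Q = 1%:M -> hsnorm (Q *m A) = hsnorm A.
Proof.
move=> QQ; apply/eqP; rewrite -(@eqrXn2 _ 2)// ?hsnorm_ge0//.
by rewrite !sqr_hsnorm_tr trmx_mul mulmxA -(mulmxA _ _ Q) QQ mulmx1.
Qed.

Lemma dotvE (R : realType) (d : nat) (v : 'cV[R]_d) :
  dotv v v = hsnorm v ^+ 2.
Proof. by rewrite sqr_hsnorm_tr /mxtrace big_ord1. Qed.

Lemma dotv_sum (R : realType) (d : nat) (u v : 'cV[R]_d) :
  dotv u v = \sum_i u i 0 * v i 0.
Proof. by rewrite /dotv mxE; apply: eq_bigr => i _; rewrite mxE. Qed.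

Lemma dotv_le (R : realType) (d : nat) (u v : 'cV[R]_d) :
  dotv u v <= hsnorm u * hsnorm v.
Proof.
rewrite -(hsnorm_trmx u); apply: le_trans (hsnormM _ _).
exact: le_trans (ler_norm _) (hsnorm_entry _ _ _).
Qed.

Lemma opnorm_set_ub (R : realType) (d : nat) (A : 'M[R]_d) (c : R) :
  0 <= c -> (forall v : 'cV_d, enorm (A *m v) <= c * enorm v) ->
  ubound [set enorm (A *m v) | v in [set v : 'cV[R]_d | enorm v <= 1]] c.
Proof.
move=> c0 Ac _ [v /= v1 <-]; apply: (le_trans (Ac v)).
by rewrite -[leRHS]mulr1 ler_wpM2l.
Qed.

Lemma opnorm_le (R : realType) (d : nat) (A : 'M[R]_d) (c : R) :
  0 <= c -> (forall v : 'cV_d, enorm (A *m v) <= c * enorm v) ->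
  opnorm A <= c.
Proof.
move=> c0 Ac; apply: ge_sup; last exact: opnorm_set_ub.
by exists (enorm (A *m 0)), 0 => //=; rewrite enormE hsnorm0.
Qed.

Lemma opnorm_le_hsnorm (R : realType) (d : nat) (A : 'M[R]_d) :
  opnorm A <= hsnorm A.
Proof.
by apply: opnorm_le => [|v]; rewrite ?hsnorm_ge0// !enormE hsnormM.
Qed.

(** The supremum defining [opnorm] is an upper bound because its set is
    bounded, by [hsnorm A]; homogeneity reduces any v to the unit ball. *)
Lemma le_opnorm (R : realType) (d : nat) (A : 'M[R]_d) (v : 'cV_d) :
  enorm (A *m v) <= opnorm A * enorm v.
Proof.
have [v0|v_neq0] := eqVneq (enorm v) 0.
  move: (v0); rewrite enormE => /hsnorm_eq0 ->.
  by rewrite mulmx0 !enormE hsnorm0 mulr0.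
have v_gt0 : 0 < enorm v by rewrite lt_def v_neq0 sqrtr_ge0.
rewrite -ler_pdivrMr// mulrC.
have -> : (enorm v)^-1 * enorm (A *m v) = enorm (A *m ((enorm v)^-1 *: v)).
  by rewrite -scalemxAr !enormE hsnormZ ger0_norm// invr_ge0 hsnorm_ge0.
apply: ub_le_sup; last first.
  exists ((enorm v)^-1 *: v) => //=.
  rewrite [leLHS]enormE hsnormZ -enormE ger0_norm ?invr_ge0 ?sqrtr_ge0//.
  by rewrite mulVf.
exists (hsnorm A); apply: opnorm_set_ub; first exact: hsnorm_ge0.
by move=> w; rewrite !enormE hsnormM.
Qed.

(** * Orthogonal projection along a step *)

(** The orthogonal projection onto the complement of s; for s = 0 the
    convention 0^-1 = 0 makes it the identity, so no case distinction on s is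
    needed below. *)
Definition perp (R : realType) (d : nat) (s : 'cV[R]_d) : 'M[R]_d :=
  1%:M - (dotv s s)^-1 *: (s *m s^T).

Lemma trmx_perp (R : realType) (d : nat) (s : 'cV[R]_d) : (perp s)^T = perp s.
Proof. by rewrite /perp linearB linearZ/= trmx1 trmx_mul trmxK. Qed.

Lemma mulmx_row_col (R : realType) (d : nat) (u v : 'cV[R]_d) :
  u^T *m v = (dotv u v)%:M.
Proof. exact: mx11_scalar. Qed.

Lemma perp_idem (R : realType) (d : nat) (s : 'cV[R]_d) :
  perp s *m perp s = perp s.
Proof.
rewrite {2}/perp mulmxBr mulmx1 -scalemxAr mulmxA.
suff -> : perp s *m s = 0 by rewrite mul0mx scaler0 subr0.
rewrite /perp mulmxBl mul1mx -scalemxAl -mulmxA mulmx_row_col mul_mx_scalar.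
rewrite scalerA dotvE; have [->|s0] := eqVneq s 0; first by rewrite scaler0 subr0.
rewrite mulVf ?scale1r ?subrr// sqrf_eq0.
by apply: contra_neq s0; exact: hsnorm_eq0.
Qed.

(** Pythagoras for the rows of X.  The subtracted term is the gain on which
    superlinear convergence rests. *)
Lemma sqr_hsnorm_mul_perp (R : realType) (p d : nat) (X : 'M[R]_(p, d))
    (s : 'cV[R]_d) :
  hsnorm (X *m perp s) ^+ 2 = hsnorm X ^+ 2 - (dotv s s)^-1 * hsnorm (X *m s) ^+ 2.
Proof.
rewrite !sqr_hsnorm_tr !trmx_mul trmx_perp mxtrace_mulC.
rewrite !mulmxA -(mulmxA X) perp_idem mxtrace_mulC mulmxA.
rewrite /perp mulmxBr mulmx1 -scalemxAr linearB linearZ/=; congr (_ - _ * _).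
by rewrite mulmxA mxtrace_mulC !mulmxA.
Qed.

Lemma hsnorm_mul_perp (R : realType) (p d : nat) (X : 'M[R]_(p, d))
    (s : 'cV[R]_d) :
  hsnorm (X *m perp s) <= hsnorm X.
Proof.
rewrite -(@ler_pXn2r _ 2)// ?nnegrE ?hsnorm_ge0// sqr_hsnorm_mul_perp.
by rewrite gerBl mulr_ge0 ?sqr_ge0// invr_ge0 dotvE sqr_ge0.
Qed.

Lemma hsnorm_perp_mul (R : realType) (d q : nat) (X : 'M[R]_(d, q))
    (s : 'cV[R]_d) :
  hsnorm (perp s *m X) <= hsnorm X.
Proof. by rewrite -hsnorm_trmx trmx_mul trmx_perp -(hsnorm_trmx X) hsnorm_mul_perp. Qed.

(** * J-symmetric matrices and the J-symmetric update *)

Lemma trmx_Jmx (R : realType) (n m : nat) : (Jmx R n m)^T = Jmx R n m.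
Proof. by rewrite /Jmx tr_block_mx !trmx0 linearN/= !trmx1. Qed.

Lemma mul_Jmx_Jmx (R : realType) (n m : nat) : Jmx R n m *m Jmx R n m = 1%:M.
Proof.
rewrite /Jmx mulmx_block !mulmx0 !mul0mx !mulmx1 !addr0 !add0r.
by rewrite mulmxN mulmx1 opprK -scalar_mx_block.
Qed.

Lemma hsnorm_Jmx (R : realType) (n m q : nat) (A : 'M[R]_(n + m, q)) :
  hsnorm (Jmx R n m *m A) = hsnorm A.
Proof. by apply: hsnorm_isom; rewrite trmx_Jmx mul_Jmx_Jmx. Qed.

(** This is what turns the J-symmetric update into a symmetric one. *)
Lemma J_symmetricP (R : realType) (n m : nat) (M : 'M[R]_(n + m)) :
  J_symmetric M <-> (Jmx R n m *m M)^T = Jmx R n m *m M.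
Proof.
rewrite /J_symmetric trmx_mul trmx_Jmx; split=> [MJ|MJ].
  by rewrite [in RHS]MJ !mulmxA mul_Jmx_Jmx mul1mx.
by rewrite -mulmxA MJ mulmxA mul_Jmx_Jmx mul1mx.
Qed.

Lemma J_symmetric_sub (R : realType) (n m : nat) (A B : 'M[R]_(n + m)) :
  J_symmetric A -> J_symmetric B -> J_symmetric (A - B).
Proof.
move=> /J_symmetricP As /J_symmetricP Bs; apply/J_symmetricP.
by rewrite mulmxBr [LHS](raddfB (@trmx R _ _))/= As Bs.
Qed.

Lemma mulmx_Jmx_jsym_update (R : realType) (n m : nat) (B : 'M[R]_(n + m))
    (s y : 'cV[R]_(n + m)) :
  let J := Jmx R n m in
  let c := (dotv s s)^-1 in
  let u := J *m (y - B *m s) in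
  J *m jsym_update B s y =
    J *m B + c *: (s *m u^T + u *m s^T) - (c ^+ 2 * dotv s u) *: (s *m s^T).
Proof.
move=> J c u.
have JJ : J *m J = 1%:M by exact: mul_Jmx_Jmx.
have eJ : (y - B *m s)^T *m J = u^T by rewrite trmx_mul trmx_Jmx.
have JseE : dotv (J *m s) (y - B *m s) = dotv s u.
  by rewrite /dotv trmx_mul trmx_Jmx mulmxA.
rewrite /jsym_update -/J JseE mulmxBr !mulmxDr -!scalemxAr.
rewrite !mulmxA JJ mul1mx -/u -(mulmxA s) eJ.
rewrite -/c mulrC -exprVn -/c.
by apply/matrixP => i j; rewrite !mxE; ring.
Qed.

Lemma J_symmetric_jsym_update (R : realType) (n m : nat) (B : 'M[R]_(n + m))
    (s y : 'cV[R]_(n + m)) :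
  J_symmetric B -> J_symmetric (jsym_update B s y).
Proof.
move=> /J_symmetricP; set J := Jmx R n m => Bsym; apply/J_symmetricP.
rewrite mulmx_Jmx_jsym_update -/J; set u := J *m (y - _).
have sym t : (t *: (s *m s^T))^T = t *: (s *m s^T).
  by rewrite linearZ/= trmx_mul trmxK.
rewrite [LHS](raddfB (@trmx R _ _))/= sym; congr (_ - _).
rewrite [LHS](raddfD (@trmx R _ _))/= Bsym linearZ/= linearD/=.
by rewrite !trmx_mul !trmxK [in LHS]addrC [_ *m s^T + _]addrC addrC.
Qed.

(** The update is Powell's symmetric update for J B.  Symmetry of M is what
    lets the terms in M gather into the two-sided projection P M P; the rest
    involves only w, which measures how far y is from A s. *)
Lemma jsym_update_error (R : realType) (n m : nat) (A B : 'M[R]_(n + m))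
    (s y : 'cV[R]_(n + m)) :
  let J := Jmx R n m in
  let M := J *m (B - A) in
  let w := J *m (y - A *m s) in
  let c := (dotv s s)^-1 in
  J_symmetric (B - A) ->
  J *m (jsym_update B s y - A) =
    perp s *m M *m perp s + c *: (s *m w^T) + c *: (perp s *m w *m s^T).
Proof.
move=> J M w c /J_symmetricP; rewrite -/J -/M => Msym.
set u := w - M *m s.
have Je : J *m (y - B *m s) = u.
  rewrite /u /w /M -mulmxA -mulmxBr mulmxBl; congr (J *m _).
  by rewrite opprB addrA subrK.
have -> : J *m (jsym_update B s y - A) =
    M + c *: (s *m u^T) + c *: (u *m s^T) - (c ^+ 2 * dotv s u) *: (s *m s^T).
  rewrite mulmxBr mulmx_Jmx_jsym_update -/J Je -/c /M mulmxBr.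
  by apply/matrixP => i j; rewrite !mxE; ring.
have -> : u^T = w^T - s^T *m M
  by rewrite -{1}Msym -trmx_mul; exact: (raddfB (@trmx R _ _)).
rewrite /u [s *m (_ - _)]mulmxBr [(_ - _) *m s^T]mulmxBl.
have -> : dotv s (w - M *m s) = dotv s w - dotv s (M *m s).
  by rewrite /dotv mulmxBr !mxE.
rewrite /perp -/c !mulmxBl !mulmxBr !mul1mx !mulmx1 -!scalemxAl -!scalemxAr.
have sws : s *m s^T *m w *m s^T = dotv s w *: (s *m s^T).
  by rewrite -(mulmxA s) mulmx_row_col mul_mx_scalar -scalemxAl.
have sMs : s *m s^T *m M *m (s *m s^T) = dotv s (M *m s) *: (s *m s^T).
  by rewrite mulmxA -(mulmxA s) -(mulmxA s) -(mulmxA s^T) mulmx_row_col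
    mul_mx_scalar -scalemxAl.
rewrite sws sMs !mulmxA !scalerBr !scalerA mulrBr scalerBl expr2.
move: (s *m w^T) (s *m s^T *m M) (M *m s *m s^T) (w *m s^T) (s *m s^T).
move: (dotv s w) (dotv s (M *m s)) => k l x1 x2 x3 x4 x5.
by apply/matrixP => i j; rewrite !mxE; ring.
Qed.

(** A gain t in the square of a number bounded by D is a gain t / (2 D) in the
    number, because a^2 - b^2 = (a - b) (a + b) <= (a - b) (2 D). *)
Lemma le_sub_of_sqr (R : realFieldType) (a b t D : R) :
  0 <= b -> b <= a -> a <= D -> 0 < D -> b ^+ 2 <= a ^+ 2 - t ->
  b <= a - t / (2 * D).
Proof.
move=> b0 ba aD D0 bat; rewrite lerBrDr -lerBrDl ler_pdivrMr; last by lra.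
have : (a - b) * (a + b) <= (a - b) * (2 * D).
  by rewrite ler_wpM2l//; lra.
have -> : (a - b) * (a + b) = a ^+ 2 - b ^+ 2 by ring.
lra.
Qed.

(** Bounded deterioration, with the gain retained: without its last term the
    estimate would give linear convergence only. *)
Lemma jsym_update_deterioration (R : realType) (n m : nat)
    (A B : 'M[R]_(n + m)) (s y : 'cV[R]_(n + m)) (kappa D : R) :
  J_symmetric (B - A) -> 0 < D -> hsnorm (B - A) <= D -> 0 <= kappa ->
  hsnorm (y - A *m s) <= kappa * hsnorm s ->
  hsnorm (jsym_update B s y - A) <=
    hsnorm (B - A) + 2 * kappa
      - (hsnorm ((B - A) *m s) / hsnorm s) ^+ 2 / (2 * D).
Proof.
move=> Esym D0 ED k0 wk; set E := B - A; set J := Jmx R n m.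
rewrite -(hsnorm_Jmx (_ - A)) jsym_update_error//; set w := J *m (y - A *m s).
rewrite -/E -/J; set c := (dotv s s)^-1.
have c0 : 0 <= c by rewrite invr_ge0 dotvE sqr_ge0.
(* c |s|^2 is 1, or 0 when s = 0. *)
have cs : c * (hsnorm s * (kappa * hsnorm s)) <= kappa.
  have -> : c * (hsnorm s * (kappa * hsnorm s)) = kappa * (c * hsnorm s ^+ 2).
    by ring.
  rewrite ler_piMr// /c dotvE; have [->|s0] := eqVneq (hsnorm s ^+ 2) 0.
    by rewrite mulr0.
  by rewrite mulVf.
have wE : hsnorm w <= kappa * hsnorm s by rewrite hsnorm_Jmx.
have rank1 (w' : 'cV_(n + m)) : hsnorm w' <= hsnorm w ->
    c * (hsnorm s * hsnorm w') <= kappa.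
  move=> w'w; apply: le_trans cs; rewrite ler_wpM2l// ler_wpM2l ?hsnorm_ge0//.
  exact: le_trans wE.
have t1 : hsnorm (c *: (s *m w^T)) <= kappa.
  rewrite hsnormZ ger0_norm//; apply: le_trans (rank1 w (lexx _)).
  by rewrite ler_wpM2l// -(hsnorm_trmx w) hsnormM.
have t2 : hsnorm (c *: (perp s *m w *m s^T)) <= kappa.
  rewrite hsnormZ ger0_norm//.
  apply: le_trans (rank1 (perp s *m w) (hsnorm_perp_mul _ _)).
  by rewrite ler_wpM2l// mulrC -(hsnorm_trmx s) hsnormM.
have main : hsnorm (perp s *m (J *m E) *m perp s) <=
    hsnorm E - (hsnorm (E *m s) / hsnorm s) ^+ 2 / (2 * D).
  rewrite -(hsnorm_Jmx E) -(hsnorm_Jmx (E *m s)) -/J [J *m (E *m s)]mulmxA.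
  rewrite -[perp s *m (J *m E) *m perp s]mulmxA.
  apply: le_sub_of_sqr => //; first exact: hsnorm_ge0.
  - exact: le_trans (hsnorm_perp_mul _ _) (hsnorm_mul_perp _ _).
  - by rewrite hsnorm_Jmx.
  apply: (@le_trans _ _ (hsnorm (J *m E *m perp s) ^+ 2)).
    by rewrite ler_pXn2r ?nnegrE ?hsnorm_ge0// hsnorm_perp_mul.
  by rewrite sqr_hsnorm_mul_perp dotvE expr_div_n [_ / _ ^+ 2]mulrC.
apply: (le_trans (hsnormD _ _)).
have := hsnormD (perp s *m (J *m E) *m perp s) (c *: (s *m w^T)).
lra.
Qed.

Lemma jsym_update0 (R : realType) (n m : nat) (B : 'M[R]_(n + m))
    (y : 'cV[R]_(n + m)) : jsym_update B 0 y = B.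
Proof.
rewrite /jsym_update [(0 : 'cV[R]_(n + m))^T]trmx0 !mulmx0 !mul0mx.
by rewrite !scaler0 subr0 !addr0.
Qed.

(** When F z = 0 the step s vanishes and so does the correction of B: the
    stopping rule agrees with the general formula. *)
Lemma jsym_stepE (R : realType) (n m : nat)
    (F : 'cV[R]_(n + m) -> 'cV[R]_(n + m)) z (B : 'M[R]_(n + m)) :
  let s := qn_dir F z B in
  jsym_step F (z, B) = (z + s, jsym_update B s (F (z + s) - F z)).
Proof.
rewrite /=; case: eqP => // Fz0.
by rewrite /qn_dir Fz0 mulmx0 oppr0 addr0 jsym_update0.
Qed.

(** * Matrices bounded below *)

(** A quantitative form of invertibility that survives small perturbations
    ([bounded_belowD]) and controls the inverse ([opnorm_invmx_le]). *)
Definition bounded_below (R : realType) (d : nat) (c : R) (A : 'M[R]_d) : Prop :=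
  forall v : 'cV[R]_d, c * hsnorm v <= hsnorm (A *m v).

Lemma unitmx_bounded_below (R : realType) (d : nat) (A : 'M[R]_d) :
  A \in unitmx -> exists2 c : R, 0 < c & bounded_below c A.
Proof.
move=> Au; have K0 := hsnorm_ge0 (invmx A).
exists (1 + hsnorm (invmx A))^-1; first by rewrite invr_gt0; lra.
move=> v; rewrite mulrC ler_pdivrMr; last by lra.
have : hsnorm v <= hsnorm (invmx A) * hsnorm (A *m v).
  by rewrite -{1}(mulKmx Au v) hsnormM.
have := hsnorm_ge0 (A *m v); lra.
Qed.

Lemma bounded_below_unitmx (R : realType) (d : nat) (c : R) (A : 'M[R]_d) :
  0 < c -> bounded_below c A -> A \in unitmx.
Proof.
move=> c0 Ac; rewrite unitmxE unitfE -det_tr; apply/det0P => -[v v0 vA].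
have Av : A *m v^T = 0 by rewrite -[A]trmxK -trmx_mul vA trmx0.
move: (Ac v^T); rewrite Av hsnorm0 pmulr_rle0// hsnorm_trmx => v_le0.
move/eqP: v0; apply; apply: hsnorm_eq0; apply/eqP.
by rewrite eq_le v_le0 hsnorm_ge0.
Qed.

Lemma bounded_belowD (R : realType) (d : nat) (c e : R) (A B : 'M[R]_d) :
  bounded_below c A -> hsnorm (B - A) <= e -> bounded_below (c - e) B.
Proof.
move=> Ac BAe v.
have : hsnorm (A *m v) <= hsnorm (B *m v) + hsnorm ((B - A) *m v).
  apply: le_trans (hsnormB _ _).
  by rewrite -mulmxBl opprB addrC subrK.
have := Ac v; have := hsnormM (B - A) v.
have : hsnorm (B - A) * hsnorm v <= e * hsnorm v.
  by rewrite ler_wpM2r ?hsnorm_ge0.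
lra.
Qed.

Lemma opnorm_invmx_le (R : realType) (d : nat) (c : R) (A : 'M[R]_d) :
  0 < c -> bounded_below c A -> opnorm (invmx A) <= c^-1.
Proof.
move=> c0 Ac; have Au := bounded_below_unitmx c0 Ac.
apply: opnorm_le => [|v]; first by rewrite invr_ge0 ltW.
rewrite !enormE mulrC ler_pdivlMr// mulrC.
by have := Ac (invmx A *m v); rewrite mulKVmx.
Qed.

(** * Local convergence of the algorithm *)

(** The only consequence of smoothness that the convergence proof uses: F
    minus the linear map A is Lipschitz near zs, with a constant proportional
    to the distance to zs. *)
Definition linearized_near (R : realType) (d : nat)
    (F : 'cV[R]_d -> 'cV[R]_d) (A : 'M[R]_d) (zs : 'cV[R]_d)
    (eps Lambda : R) : Prop :=
  forall u v : 'cV[R]_d, hsnorm (u - zs) < eps -> hsnorm (v - zs) < eps ->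
    hsnorm (F u - F v - A *m (u - v)) <=
      Lambda * (hsnorm (u - zs) + hsnorm (v - zs)) * hsnorm (u - v).

(** One step of the algorithm near the solution.  The contraction factor comes
    from B (z' - zs) = (B - A) (z - zs) - (F z - A (z - zs)), and the refined
    estimate from F z' = (F z' - F z - A s) - (B - A) s together with the lower
    bound of A. *)
Lemma jsym_step_estimates (R : realType) (n m : nat)
    (F : 'cV[R]_(n + m) -> 'cV[R]_(n + m)) (A : 'M[R]_(n + m))
    (zs : 'cV[R]_(n + m)) (eps Lambda c r : R) z (B : 'M[R]_(n + m)) :
  0 <= Lambda -> 0 < c -> 0 < r -> r < 1 ->
  F zs = 0 -> J_symmetric A -> bounded_below c A ->
  linearized_near F A zs eps Lambda ->
  hsnorm (z - zs) < eps -> Lambda * hsnorm (z - zs) <= c * r / 4 ->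
  J_symmetric B -> hsnorm (B - A) <= c * r / 4 ->
  let s := qn_dir F z B in
  let z' := z + s in
  let B' := jsym_update B s (F z' - F z) in
  let theta := hsnorm ((B - A) *m s) / hsnorm s in
  [/\ bounded_below (c / 2) B,
      hsnorm (z' - zs) <= r * hsnorm (z - zs),
      J_symmetric B',
      hsnorm (B' - A) <= hsnorm (B - A) + 4 * Lambda * hsnorm (z - zs)
        - theta ^+ 2 / (c * r / 2)
    & hsnorm (z' - zs)
        <= 4 / c * (2 * Lambda * hsnorm (z - zs) + theta) * hsnorm (z - zs)].
Proof.
move=> L0 c0 r0 r1 Fzs Asym Ac lin ze Lze Bsym BA s z' B' theta.
set e := hsnorm (z - zs) in ze Lze *; set e' := hsnorm (z' - zs).
have e0 : 0 <= e by exact: hsnorm_ge0.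
have e'0 : 0 <= e' by exact: hsnorm_ge0.
have eps0 : 0 < eps by exact: le_lt_trans ze.
have cr : c * r < c by rewrite gtr_pMr.
have cr0 : 0 < c * r by rewrite mulr_gt0.
have Bc : bounded_below (c / 2) B.
  move=> v; apply: le_trans (bounded_belowD Ac BA v).
  by rewrite ler_wpM2r ?hsnorm_ge0//; lra.
have Bu : B \in unitmx by apply: bounded_below_unitmx Bc; lra.
have Bs : B *m s = - F z by rewrite /s /qn_dir mulmxN mulKVmx.
have linz : hsnorm (F z - A *m (z - zs)) <= Lambda * e * e.
  have := lin z zs ze; rewrite subrr hsnorm0 => /(_ eps0).
  by rewrite Fzs subr0 addr0.
have contr : e' <= r * e.
  have Bz' : B *m (z' - zs) = (B - A) *m (z - zs) - (F z - A *m (z - zs)).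
    by rewrite /z' addrAC mulmxDr Bs mulmxBl opprB addrA subrK.
  have := Bc (z' - zs); rewrite Bz' -/e'.
  have := hsnormB ((B - A) *m (z - zs)) (F z - A *m (z - zs)).
  have := hsnormM (B - A) (z - zs); rewrite -/e.
  have : hsnorm (B - A) * e <= c * r / 4 * e by rewrite ler_wpM2r.
  have : Lambda * e * e <= c * r / 4 * e by rewrite ler_wpM2r.
  move=> h1 h2 h3 h4 h5.
  rewrite -(@ler_pM2l _ (c / 2)); last by lra.
  lra.
have e'e : e' <= e by apply: le_trans contr _; rewrite ler_piMl// ltW.
have z'e : hsnorm (z' - zs) < eps by exact: le_lt_trans ze.
have z'zE : z' - z = s by rewrite /z' addrC addKr.
have L2 : Lambda * (e' + e) <= 2 * Lambda * e.
  by have := ler_wpM2l L0 e'e; lra.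
have yAs : hsnorm (F z' - F z - A *m s) <= 2 * Lambda * e * hsnorm s.
  have := lin z' z z'e ze; rewrite z'zE => /le_trans; apply.
  by rewrite ler_wpM2r ?hsnorm_ge0.
split => //.
- exact: J_symmetric_jsym_update.
- have := jsym_update_deterioration (J_symmetric_sub Bsym Asym) _ BA _ yAs.
  rewrite -/theta -/B' => h; have {}h := h _ _; move: h.
  have -> : 2 * (c * r / 4) = c * r / 2 by field.
  have -> : 2 * (2 * Lambda * e) = 4 * Lambda * e by ring.
  by apply; [lra | rewrite !mulr_ge0].
- have s_le : hsnorm s <= 2 * e.
    have -> : s = (z' - zs) - (z - zs) by rewrite opprB addrA subrK z'zE.
    by apply: le_trans (hsnormB _ _) _; rewrite -/e -/e'; lra.
  (* For s = 0 the quotient theta is 0 by convention. *)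
  have theta_s : hsnorm ((B - A) *m s) <= theta * hsnorm s.
    have [/hsnorm_eq0 ->|s0] := eqVneq (hsnorm s) 0.
      by rewrite mulmx0 !hsnorm0 mulr0.
    by rewrite /theta divfK.
  have theta0 : 0 <= theta by rewrite divr_ge0 ?hsnorm_ge0.
  have Fz' : hsnorm (F z') <= (2 * Lambda * e + theta) * hsnorm s.
    have -> : F z' = (F z' - F z - A *m s) - (B - A) *m s.
      by rewrite mulmxBl Bs opprD !opprK [_ + A *m s]addrC addrA !subrK.
    by apply: le_trans (hsnormB _ _) _; lra.
  have linz' : hsnorm (F z' - A *m (z' - zs)) <= Lambda * e' * e'.
    have := lin z' zs z'e; rewrite subrr hsnorm0 => /(_ eps0).
    by rewrite Fzs subr0 addr0.
  have Az' : c * e' <= hsnorm (F z') + Lambda * e' * e'.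
    apply: le_trans (Ac _) _.
    have -> : A *m (z' - zs) = F z' - (F z' - A *m (z' - zs)).
      by rewrite opprB addrCA subrr addr0.
    by apply: le_trans (hsnormB _ _) _; lra.
  have q0 : 0 <= 2 * Lambda * e + theta by rewrite addr_ge0// !mulr_ge0.
  have := ler_wpM2l q0 s_le.
  have : Lambda * e' * e' <= c / 4 * e'.
    by rewrite ler_wpM2r//; have := ler_wpM2l L0 e'e; lra.
  have := mulr_ge0 q0 e0.
  set q := 2 * Lambda * e + theta in Fz' *; move=> h1 h2 h3.
  have -> : 4 / c * q * e = 4 * q * e / c by field; rewrite gt_eqF.
  rewrite ler_pdivlMr//; lra.
Qed.

(** The topology of matrices is that of the sup norm, which [hsnorm]
    dominates entrywise. *)
Lemma cvg_hsnorm (R : realType) (p q : nat) (u : nat -> 'M[R]_(p, q))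
    (l : 'M[R]_(p, q)) :
  (fun k => hsnorm (u k - l)) @ \oo --> (0 : R) -> u @ \oo --> l.
Proof.
move=> /cvgrPdist_lt h; apply/cvg_ballP => e e0.
near=> k; split=> // i j; rewrite /ball/= distrC.
have -> : u k i j - l i j = (u k - l) i j by rewrite !mxE.
apply: le_lt_trans (hsnorm_entry _ _ _) _.
have : `|0 - hsnorm (u k - l)| < e by near: k; exact: h.
by rewrite sub0r normrN ger0_norm// hsnorm_ge0.
Unshelve. all: by end_near. Qed.

Lemma qn_zS (R : realType) (n m : nat)
    (F : 'cV[R]_(n + m) -> 'cV[R]_(n + m)) z0 (B0 : 'M[R]_(n + m)) k :
  qn_z F z0 B0 k.+1 =
    qn_z F z0 B0 k + qn_dir F (qn_z F z0 B0 k) (qn_B F z0 B0 k).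
Proof.
rewrite /qn_z /qn_B iterS; case: (iter _ _ _) => z B.
by rewrite jsym_stepE.
Qed.

Lemma qn_BS (R : realType) (n m : nat)
    (F : 'cV[R]_(n + m) -> 'cV[R]_(n + m)) z0 (B0 : 'M[R]_(n + m)) k :
  qn_B F z0 B0 k.+1 =
    jsym_update (qn_B F z0 B0 k) (qn_dir F (qn_z F z0 B0 k) (qn_B F z0 B0 k))
      (F (qn_z F z0 B0 k.+1) - F (qn_z F z0 B0 k)).
Proof.
rewrite qn_zS /qn_z /qn_B iterS; case: (iter _ _ _) => z B.
by rewrite jsym_stepE.
Qed.

(** The potential phi converges, being nonincreasing and nonnegative, so its
    successive drops tend to 0, and they dominate t^2. *)
Lemma cvg0_of_potential_drop (R : realType) (phi t : nat -> R) (a : R) :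
  0 < a -> (forall k, 0 <= phi k) -> (forall k, 0 <= t k) ->
  (forall k, phi k.+1 <= phi k - t k ^+ 2 / a) ->
  t @ \oo --> (0 : R).
Proof.
move=> a0 phi0 t0 phiS.
have drop k : t k ^+ 2 <= a * (phi k - phi k.+1).
  by rewrite -ler_pdivrMl// mulrC; have := phiS k; lra.
have phi_cvg : cvgn phi.
  apply: nonincreasing_is_cvgn.
    apply/nonincreasing_seqP => k; apply: le_trans (phiS k) _.
    by rewrite gerBl mulr_ge0 ?sqr_ge0// invr_ge0 ltW.
  by exists 0 => _ [k _ <-].
have drop0 : (fun k => Num.sqrt (a * (phi k - phi k.+1))) @ \oo --> (0 : R).
  have : (fun k => Num.sqrt (a * (phi k - phi k.+1))) @ \oo -->
      Num.sqrt (a * (limn phi - limn phi)).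
    apply: continuous_cvg; first exact: sqrt_continuous.
    apply: cvgMr; apply: cvgB => //.
    by rewrite (cvg_shiftS phi).
  by rewrite subrr mulr0 sqrtr0.
apply: (squeeze_cvgr _ (cvg_cst 0) drop0).
near=> k; rewrite t0/= -(ger0_norm (t0 k)) -sqrtr_sqr ler_wsqrtr//.
Unshelve. all: by end_near. Qed.

(** The local convergence theorem for any F that satisfies the two-point
    estimate, whether or not it comes from a saddle function. *)
Theorem jsym_local_convergence (R : realType) (n m : nat)
    (F : 'cV[R]_(n + m) -> 'cV[R]_(n + m)) (A : 'M[R]_(n + m))
    (zs : 'cV[R]_(n + m)) (eps Lambda r : R) :
  0 < eps -> 0 < Lambda -> 0 < r -> r < 1 ->
  F zs = 0 -> A \in unitmx -> J_symmetric A ->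
  linearized_near F A zs eps Lambda ->
  exists epsbar delta : R, [/\ 0 < epsbar, 0 < delta &
    forall (z0 : 'cV[R]_(n + m)) (B0 : 'M[R]_(n + m)),
      enorm (z0 - zs) < epsbar ->
      J_symmetric B0 ->
      fnorm (B0 - A) < delta ->
      let z := qn_z F z0 B0 in
      let B := qn_B F z0 B0 in
      [/\ qn_well_defined F z0 B0,
          z @ \oo --> zs,
          (exists C : R, forall k : nat,
             opnorm (B k) <= C /\ opnorm (invmx (B k)) <= C),
          (forall k : nat, enorm (z k.+1 - zs) <= r * enorm (z k - zs))
        & Q_superlinear z zs]].
Proof.
move=> eps0 L0 r0 r1 Fzs Au Asym lin.
have [c c0 Ac] := unitmx_bounded_below Au.
have cr0 : 0 < c * r by rewrite mulr_gt0.
have r1' : 0 < 1 - r by lra.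
(* The increments of the error matrix add up to at most
   K = 4 Lambda b / (1 - r), where b is the initial distance.  The choice of
   epsbar gives K <= c r / 8; with delta = c r / 8 the error matrix then never
   exceeds c r / 4, as the contraction by r requires. *)
exists (Num.min eps (c * r / 32 * (1 - r) / Lambda)), (c * r / 8); split.
- by rewrite lt_min eps0/= divr_gt0// mulr_gt0//; lra.
- by lra.
move=> z0 B0; rewrite enormE lt_min => /andP[z0e]; rewrite ltr_pdivlMr// => z0L.
move=> B0sym B0A z B.
pose b := hsnorm (z0 - zs); pose K := 4 * Lambda * b / (1 - r).
have b0 : 0 <= b by exact: hsnorm_ge0.
have K0 : 0 <= K by rewrite divr_ge0 ?mulr_ge0// ltW.
have K_le : K <= c * r / 8.
  by rewrite /K ler_pdivrMr//; rewrite -/b in z0L; lra.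
have Lb : Lambda * b <= c * r / 4.
  have : c * r / 32 * (1 - r) <= c * r / 32 by rewrite ler_piMr; lra.
  by rewrite -/b in z0L; lra.
have rk0 k : 0 <= r ^+ k by rewrite exprn_ge0// ltW.
have rk1 k : r ^+ k <= 1 by rewrite exprn_ile1// ltW.
(* K r^k is the part of K that remains to be spent from step k on, which makes
   phi nonincreasing. *)
pose phi k := hsnorm (B k - A) + K * r ^+ k.
pose theta k := hsnorm ((B k - A) *m qn_dir F (z k) (B k))
  / hsnorm (qn_dir F (z k) (B k)).
pose inv k := [/\ hsnorm (z k - zs) <= r ^+ k * b, J_symmetric (B k)
                & phi k <= c * r / 4].
have step k : inv k ->
  [/\ bounded_below (c / 2) (B k),
      hsnorm (z k.+1 - zs) <= r * hsnorm (z k - zs),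
      J_symmetric (B k.+1),
      phi k.+1 <= phi k - theta k ^+ 2 / (c * r / 2)
    & hsnorm (z k.+1 - zs) <=
        4 / c * (2 * Lambda * hsnorm (z k - zs) + theta k) * hsnorm (z k - zs)].
  move=> [zk Bk phik].
  have zkb : hsnorm (z k - zs) <= b by apply: le_trans zk _; rewrite ler_piMl.
  have Kk : 0 <= K * r ^+ k by rewrite mulr_ge0.
  have EBk : hsnorm (B k - A) <= c * r / 4 by move: phik; rewrite /phi; lra.
  have [] := jsym_step_estimates (ltW L0) c0 r0 r1 Fzs Asym Ac lin
    (le_lt_trans zkb z0e) _ Bk EBk.
    by apply: le_trans Lb; rewrite ler_pM2l.
  rewrite -qn_zS -qn_BS -/z -/B -/(theta k) => h1 h2 h3 h4 h5; split => //.
  rewrite /phi exprS.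
  have KE : K * (1 - r) = 4 * Lambda * b by rewrite /K divfK// gt_eqF.
  have : 4 * Lambda * hsnorm (z k - zs) <= 4 * Lambda * (r ^+ k * b).
    by rewrite ler_pM2l// mulr_gt0.
  have -> : 4 * Lambda * (r ^+ k * b) = K * r ^+ k - K * (r * r ^+ k).
    by rewrite mulrCA -KE; ring.
  lra.
have invk k : inv k.
  elim: k => [|k IH].
    split => //; first by rewrite expr0 mul1r.
    rewrite /phi expr0 mulr1; have : hsnorm (B 0%N - A) < c * r / 8 by [].
    by lra.
  have [_ h2 h3 h4 _] := step k IH; have [zk _ phik] := IH; split => //.
    by apply: le_trans h2 _; rewrite exprS -mulrA ler_pM2l.
  apply: le_trans phik; apply: le_trans h4 _.
  by rewrite gerBl divr_ge0 ?sqr_ge0//; lra.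
have rb_cvg : (fun k => r ^+ k * b) @ \oo --> (0 : R).
  rewrite -(mul0r b); apply: cvgMl; apply: cvg_expr.
  by rewrite ger0_norm// ltW.
have e_cvg : (fun k => hsnorm (z k - zs)) @ \oo --> (0 : R).
  apply: (squeeze_cvgr _ (cvg_cst 0) rb_cvg).
  by apply: nearW => k; rewrite hsnorm_ge0/=; have [] := invk k.
have theta_ge0 k : 0 <= theta k by rewrite divr_ge0 ?hsnorm_ge0.
have theta_cvg : theta @ \oo --> (0 : R).
  apply: (@cvg0_of_potential_drop _ phi _ (c * r / 2)) => // [|k|k]; first by lra.
    by apply: addr_ge0; [exact: hsnorm_ge0|exact: mulr_ge0].
  by have [] := step k (invk k).
split.
- move=> k /=; have [Bk _ _ _ _] := step k (invk k).
  have Bu : B k \in unitmx by apply: bounded_below_unitmx Bk; lra.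
  split => // Fz; rewrite dotvE => /eqP; rewrite sqrf_eq0 => /eqP /hsnorm_eq0.
  rewrite /qn_dir => /eqP; rewrite oppr_eq0 => /eqP BF; apply: Fz.
  by rewrite -(mulKVmx Bu (F _)) BF mulmx0.
- exact: cvg_hsnorm.
- exists (Num.max (hsnorm A + c * r / 4) (c / 2)^-1) => k.
  have [Bk _ _ _ _] := step k (invk k); have [_ _ phik] := invk k.
  rewrite !le_max; split.
    apply/orP; left; apply: le_trans (opnorm_le_hsnorm _) _.
    have -> : B k = A + (B k - A) by rewrite addrC subrK.
    apply: le_trans (hsnormD _ _) _; rewrite lerD2l.
    by apply: le_trans phik; rewrite lerDl mulr_ge0.
  by apply/orP; right; apply: opnorm_invmx_le => //; lra.
- by move=> k; rewrite !enormE; have [] := step k (invk k).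
- exists (fun k => 4 / c * (2 * Lambda * hsnorm (z k - zs) + theta k)); split.
    rewrite -(mulr0 (4 / c)); apply: cvgMr; rewrite -[X in _ --> X]addr0.
    by apply: cvgD => //; rewrite -(mulr0 (2 * Lambda)); exact: cvgMr.
  by move=> k; rewrite !enormE; have [] := step k (invk k).
Qed.

(** * Directional derivatives, Jacobians and Hessians *)

(** Both derivatives are limits of the same difference quotient, so no chain
    rule is involved. *)
Lemma is_derive_line (R : realType) (V : normedModType R) (f : V -> R)
    (a v : V) (t df : R) :
  is_derive (a + t *: v) v f df -> is_derive t (1 : R) (fun x : R => f (a + x *: v)) df.
Proof.
have quot : (fun h : R => h^-1 *: (((fun x => f (a + x *: v)) \o shift t) (h *: 1)
      - f (a + t *: v))) =
    (fun h : R => h^-1 *: ((f \o shift (a + t *: v)) (h *: v) - f (a + t *: v))).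
  apply/funext => h /=; congr (_ *: (f _ - _)).
  by rewrite /shift/= [h *: 1]mulr1 scalerDl addrCA.
move=> [fv <-]; split; first by rewrite /derivable quot.
by rewrite /derive quot.
Qed.

Lemma MVT_is_derive (R : realType) (g dg : R -> R) (h : R) :
  0 < h -> (forall t : R, is_derive t 1 g (dg t)) ->
  exists2 t, 0 < t < h & g h - g 0 = h * dg t.
Proof.
move=> h0 gd; have [|t] := @MVT R g dg 0 h h0 (fun t _ => gd t).
  by apply: derivable_within_continuous => t _; have [] := gd t.
by rewrite in_itv/= subr0 mulrC => t0h E; exists t.
Qed.

Lemma differentiable_entry (R : realType) (V : normedModType R) (d : nat)
    (G : V -> 'cV[R]_d) (x : V) i :
  differentiable G x -> differentiable (fun x => G x i 0) x.
Proof.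
move=> Gd; apply: (@differentiable_comp _ _ _ _ G (fun N : 'cV[R]_d => N i 0)) => //.
exact: differentiable_coord.
Qed.

Lemma derive_partial (R : realType) (d : nat) (f : 'cV[R]_d -> R)
    (x v : 'cV[R]_d) :
  differentiable f x -> 'D_v f x = \sum_j v j 0 * partial j f x.
Proof.
move=> fd; rewrite deriveE//.
have {1}-> : v = \sum_j v j 0 *: delta_mx j 0.
  by rewrite [LHS]matrix_sum_delta; apply: eq_bigr => i _; rewrite big_ord1.
rewrite linear_sum; apply: eq_bigr => j _.
by rewrite linearZ /partial deriveE.
Qed.

(** Schwarz's theorem.  The second difference S of f over a parallelogram of
    side h is symmetric in the two directions, and two applications of the
    mean value theorem make it h^2 times a mixed second derivative at a nearby
    point, in either order; continuity of the Hessian at z concludes. *)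
Lemma jac_grad_sym (R : realType) (d : nat) (f : 'cV[R]_d -> R) z :
  (forall x, differentiable f x) ->
  (forall x, differentiable (grad f) x) ->
  {for z, continuous (jac (grad f))} ->
  (jac (grad f) z)^T = jac (grad f) z.
Proof.
move=> fd gd Hc; apply/matrixP => i j; rewrite mxE.
have gradE k : (fun x => grad f x k 0) = partial k f.
  by apply/funext => x; rewrite mxE.
have pd k x : differentiable (partial k f) x.
  by rewrite -gradE; exact: differentiable_entry.
pose S i' j' h := f (z + h *: delta_mx j' 0 + h *: delta_mx i' 0)
  - f (z + h *: delta_mx i' 0) - (f (z + h *: delta_mx j' 0) - f z).
have SC i' j' h : S i' j' h = S j' i' h
  by rewrite /S [z + h *: delta_mx j' 0 + _]addrAC; ring.
have second i' j' h : 0 < h -> exists s t : R, [/\ 0 < s < h, 0 < t < h &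
    S i' j' h =
      h * (h * jac (grad f) (z + s *: delta_mx i' 0 + t *: delta_mx j' 0) i' j')].
  move=> h0.
  have line k a t : is_derive t (1 : R) (fun x : R => f (a + x *: delta_mx k 0))
      (partial k f (a + t *: delta_mx k 0)).
    by apply: is_derive_line; apply/derivableP; exact: diff_derivable.
  have [s s0h Es] := MVT_is_derive h0 (fun t =>
    is_deriveB (line i' (z + h *: delta_mx j' 0) t) (line i' z t)).
  have line2 t : is_derive t (1 : R)
      (fun x : R => partial i' f (z + s *: delta_mx i' 0 + x *: delta_mx j' 0))
      (partial j' (partial i' f) (z + s *: delta_mx i' 0 + t *: delta_mx j' 0)).
    by apply: is_derive_line; apply/derivableP; exact: diff_derivable.
  have [t t0h Et] := MVT_is_derive h0 line2.
  exists s, t; split => //; rewrite [jac _ _ _ _]mxE gradE -Et.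
  move: Es; rewrite !fctE !scale0r !addr0 [z + h *: _ + s *: _]addrAC => <-.
  by rewrite /S; ring.
have near_z i' j' (e : R) : 0 < e -> exists2 h, 0 < h &
    forall s t, 0 < s < h -> 0 < t < h ->
    `|jac (grad f) z i' j' -
      jac (grad f) (z + s *: delta_mx i' 0 + t *: delta_mx j' 0) i' j'| < e.
  move=> e0.
  have /cvgrPdist_lt/(_ e e0) : (fun x => jac (grad f) x i' j') @ z -->
      jac (grad f) z i' j'.
    apply: (@cvg_comp _ _ _ (jac (grad f)) (fun N : 'M[R]_d => N i' j')).
      exact: Hc.
    exact: coord_continuous.
  rewrite nearE => /nbhs_ballP[dl /= dl0 dlP]; exists (dl / 2); first by lra.
  move=> s t /andP[s0 sdl] /andP[t0 tdl]; apply: dlP; split => // k l.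
  rewrite /ball/= !mxE; set p := (_ && _)%:R; set q := (_ && _)%:R.
  have p01 : 0 <= p <= 1 by rewrite ler0n lern1 leq_b1.
  have q01 : 0 <= q <= 1 by rewrite ler0n lern1 leq_b1.
  have -> : z k l - (z k l + s * p + t * q) = - (s * p + t * q) by ring.
  have [p0 p1] := andP p01; have [q0 q1] := andP q01.
  have sp0 : 0 <= s * p by rewrite mulr_ge0// ltW.
  have sp : s * p <= s by rewrite ler_piMr// ltW.
  have tq0 : 0 <= t * q by rewrite mulr_ge0// ltW.
  have tq : t * q <= t by rewrite ler_piMr// ltW.
  rewrite normrN ger0_norm ?addr_ge0//.
  apply: le_lt_trans (lerD sp tq) _; rewrite (splitr dl) ltrD//.
apply/eqP; rewrite -subr_eq0 -normr_le0; apply/ler_addgt0Pr => e e0.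
rewrite add0r; have e20 : 0 < e / 2 by lra.
have [h1 h10 H1] := near_z i j _ e20; have [h2 h20 H2] := near_z j i _ e20.
pose h := Num.min h1 h2; have h0 : 0 < h by rewrite lt_min h10.
have [s [t [s0h t0h E1]]] := second i j h h0.
have [s' [t' [s0h' t0h' E2]]] := second j i h h0.
have lt1 x : 0 < x < h -> 0 < x < h1 by rewrite lt_min => /and3P[-> ->].
have lt2 x : 0 < x < h -> 0 < x < h2 by rewrite lt_min => /and3P[-> _ ->].
have /(mulfI (lt0r_neq0 h0)) /(mulfI (lt0r_neq0 h0)) E :=
  etrans (esym E1) (etrans (SC i j h) E2).
have close (x x' a a' : R) : `|a - x| < e / 2 -> `|a' - x'| < e / 2 -> x = x' ->
    `|a' - a| <= e.
  move=> ax ax' xx'; have -> : a' - a = (a' - x') - (a - x) by rewrite xx'; ring.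
  by apply/ltW/(le_lt_trans (ler_normB _ _)); lra.
exact: close (H1 s t (lt1 _ s0h) (lt1 _ t0h)) (H2 s' t' (lt2 _ s0h') (lt2 _ t0h')) E.
Qed.

Lemma is_derive_dotv_line (R : realType) (d : nat) (G : 'cV[R]_d -> 'cV[R]_d)
    (p v w : 'cV[R]_d) (t : R) :
  (forall x, differentiable G x) ->
  is_derive t (1 : R) (fun x : R => dotv p (G (v + x *: w)))
    (dotv p (jac G (v + t *: w) *m w)).
Proof.
move=> Gd.
have coord i : is_derive t (1 : R) (fun x : R => G (v + x *: w) i 0)
    ((jac G (v + t *: w) *m w) i 0).
  apply: (@is_derive_line _ _ (fun x => G x i 0)).
  have Gi := differentiable_entry i (Gd (v + t *: w)).
  have -> : (jac G (v + t *: w) *m w) i 0 = 'D_w (fun x => G x i 0) (v + t *: w).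
    rewrite derive_partial// mxE; apply: eq_bigr => j _.
    by rewrite mxE mulrC.
  by apply/derivableP; exact: diff_derivable.
have := is_derive_sum (fun i => is_deriveZ (p i 0) (coord i)).
rewrite dotv_sum; congr is_derive.
by apply/funext => x; rewrite dotv_sum fct_sumE.
Qed.

(** For vector-valued G the mean value theorem is applied to the scalar
    function p . G along the segment, where p is the very error to be
    estimated: this gives |p|^2 <= |p| (bound).  The intermediate point is a
    convex combination of u and v, so its distance to zs is at most the sum of
    theirs. *)
Lemma jac_linearized_near (R : realType) (d : nat) (G : 'cV[R]_d -> 'cV[R]_d)
    (zs : 'cV[R]_d) (eps Lambda : R) :
  0 <= Lambda -> (forall x, differentiable G x) ->
  (forall z v : 'cV[R]_d, hsnorm (z - zs) < eps ->
    hsnorm ((jac G z - jac G zs) *m v) <= Lambda * hsnorm (z - zs) * hsnorm v) ->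
  linearized_near G (jac G zs) zs eps Lambda.
Proof.
move=> L0 Gd lip u v ue ve; set w := u - v; set A := jac G zs.
set p := G u - G v - A *m w.
have [t /andP[t0 t1]] := MVT_is_derive ltr01 (fun t =>
  is_derive_dotv_line p v w t Gd).
rewrite scale1r scale0r addr0 mul1r (_ : v + w = u); last by rewrite addrC subrK.
set xi := v + t *: w => E.
have xiE : xi - zs = (1 - t) *: (v - zs) + t *: (u - zs).
  by apply/matrixP => i j; rewrite !mxE; ring.
have xi_le : hsnorm (xi - zs) <= (1 - t) * hsnorm (v - zs) + t * hsnorm (u - zs).
  rewrite xiE; apply: le_trans (hsnormD _ _) _.
  by rewrite !hsnormZ !ger0_norm ?subr_ge0// ltW.
have u0 := hsnorm_ge0 (u - zs); have v0 := hsnorm_ge0 (v - zs).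
have t1' : 0 < 1 - t by lra.
have xi_eps : hsnorm (xi - zs) < eps.
  apply: le_lt_trans xi_le _.
  have -> : eps = (1 - t) * eps + t * eps by ring.
  by rewrite ltrD// ltr_pM2l.
have xi_sum : hsnorm (xi - zs) <= hsnorm (u - zs) + hsnorm (v - zs).
  apply: le_trans xi_le _; rewrite addrC lerD// ler_piMl//; lra.
have pp : hsnorm p ^+ 2 = dotv p ((jac G xi - A) *m w).
  rewrite -dotvE {2}/p mulmxBl.
  have dotvB x y : dotv p (x - y) = dotv p x - dotv p y.
    by rewrite /dotv mulmxBr !mxE.
  by rewrite !dotvB E.
have : hsnorm p ^+ 2 <=
    hsnorm p * (Lambda * (hsnorm (u - zs) + hsnorm (v - zs)) * hsnorm w).
  rewrite pp; apply: le_trans (dotv_le _ _) _; rewrite ler_wpM2l ?hsnorm_ge0//.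
  apply: le_trans (lip _ _ xi_eps) _.
  by rewrite ler_wpM2r ?hsnorm_ge0// ler_wpM2l.
have [->|p_neq0] := eqVneq (hsnorm p) 0.
  by rewrite !mulr_ge0 ?addr_ge0 ?hsnorm_ge0.
by rewrite expr2 ler_pM2l// lt_def p_neq0 hsnorm_ge0.
Qed.

Lemma jac_mulmx (R : realType) (d : nat) (Q : 'M[R]_d)
    (G : 'cV[R]_d -> 'cV[R]_d) z :
  differentiable G z -> jac (fun x => Q *m G x) z = Q *m jac G z.
Proof.
move=> Gd; apply/matrixP => i j; rewrite !mxE.
have Gk k : derivable (fun x => G x k 0) z (delta_mx j 0).
  by apply: diff_derivable; exact: differentiable_entry.
have -> : (fun x => (Q *m G x) i 0) = \sum_k (Q i k *: (fun x => G x k 0)).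
  by apply/funext => x; rewrite mxE fct_sumE.
rewrite /partial derive_sum => [|k]; last exact: derivableZ.
by apply: eq_bigr => k _; rewrite deriveZ// mxE.
Qed.

(** * The saddle field *)

(** The sign change in the second block is exactly J; each partial gradient
    of L is a block of the gradient of [saddle_fun L] because the difference
    quotients coincide. *)
Lemma saddle_fieldE (R : realType) (n m : nat)
    (L : 'cV[R]_n -> 'cV[R]_m -> R) (z : 'cV[R]_(n + m)) :
  saddle_field L z = Jmx R n m *m grad (saddle_fun L) z.
Proof.
rewrite -[grad _ z]vsubmxK /Jmx mul_block_col !mul1mx !mul0mx addr0 add0r.
rewrite mulNmx mul1mx /saddle_field; congr (col_mx _ (- _)).
  apply/colP => i; rewrite !mxE /partial /derive; congr (lim _).
  suff -> : (fun h => h^-1 *: (((fun x => L x (dsubmx z)) \o shift (usubmx z))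
      (h *: delta_mx i 0) - L (usubmx z) (dsubmx z))) =
    (fun h => h^-1 *: ((saddle_fun L \o shift z) (h *: delta_mx (lshift m i) 0)
      - saddle_fun L z)) by [].
  apply/funext => h /=; congr (_ *: (_ - _)).
  rewrite /saddle_fun /shift/=; congr (L _ _); apply/colP => j; rewrite !mxE.
    by rewrite eq_lshift.
  by rewrite eq_rlshift/= mulr0 add0r.
apply/colP => i; rewrite !mxE /partial /derive; congr (lim _).
suff -> : (fun h => h^-1 *: (((fun x => L (usubmx z) x) \o shift (dsubmx z))
    (h *: delta_mx i 0) - L (usubmx z) (dsubmx z))) =
  (fun h => h^-1 *: ((saddle_fun L \o shift z) (h *: delta_mx (rshift n i) 0)
    - saddle_fun L z)) by [].
apply/funext => h /=; congr (_ *: (_ - _)).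
rewrite /saddle_fun /shift/=; congr (L _ _); apply/colP => j; rewrite !mxE.
  by rewrite eq_lrshift/= mulr0 add0r.
by rewrite eq_rshift.
Qed.

Theorem theorem3p2 (R : realType) (n m : nat)
    (L : 'cV[R]_n -> 'cV[R]_m -> R)
    (L_diff3 : thrice_differentiable (saddle_fun L))
    (zs : 'cV[R]_(n + m))
    (F_zs : saddle_field L zs = 0)
    (jac_unit : jac (saddle_field L) zs \in unitmx)
    (gamma : R) (gammaE : gamma = opnorm (invmx (jac (saddle_field L) zs)))
    (eps Lambda : R) (eps_gt0 : 0 < eps) (Lambda_gt0 : 0 < Lambda)
    (jac_lip : forall z : 'cV[R]_(n + m), enorm (z - zs) < eps ->
      opnorm (jac (saddle_field L) z - jac (saddle_field L) zs)
        <= Lambda * enorm (z - zs))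
    (r : R) (r_gt0 : 0 < r) (r_lt1 : r < 1) :
  exists epsbar delta : R, [/\ 0 < epsbar, 0 < delta &
    forall (z0 : 'cV[R]_(n + m)) (B0 : 'M[R]_(n + m)),
      enorm (z0 - zs) < epsbar ->
      J_symmetric B0 ->
      fnorm (B0 - jac (saddle_field L) zs) < delta ->
      let z := qn_z (saddle_field L) z0 B0 in
      let B := qn_B (saddle_field L) z0 B0 in
      [/\ qn_well_defined (saddle_field L) z0 B0,
          z @ \oo --> zs,
          (exists C : R, forall k : nat,
             opnorm (B k) <= C /\ opnorm (invmx (B k)) <= C),
          (forall k : nat, enorm (z k.+1 - zs) <= r * enorm (z k - zs))
        & Q_superlinear z zs]].
Proof.
set J := Jmx R n m; set f := saddle_fun L in L_diff3.
have FE : saddle_field L = fun z => J *m grad f z.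
  by apply/funext => z; exact: saddle_fieldE.
have gd x : differentiable (grad f) x by have [] := L_diff3 x.
have jacE z : jac (saddle_field L) z = J *m jac (grad f) z.
  by rewrite FE jac_mulmx.
have Asym : J_symmetric (jac (saddle_field L) zs).
  apply/J_symmetricP; rewrite jacE mulmxA mul_Jmx_Jmx mul1mx.
  apply: jac_grad_sym => // [x|]; first by have [] := L_diff3 x.
  by apply: differentiable_continuous; have [] := L_diff3 zs.
apply: (jsym_local_convergence eps_gt0 Lambda_gt0) => //.
have grad_lin : linearized_near (grad f) (jac (grad f) zs) zs eps Lambda.
  apply: jac_linearized_near => // [|z v ze]; first exact: ltW.
  rewrite -hsnorm_Jmx mulmxA mulmxBr -!jacE -enormE.
  apply: le_trans (le_opnorm _ _) _; rewrite enormE ler_wpM2r ?hsnorm_ge0//.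
  by rewrite -enormE jac_lip// enormE.
move=> u v ue ve; rewrite jacE FE -mulmxA -!mulmxBr hsnorm_Jmx.
exact: grad_lin.
Qed.
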